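(* Let $X_t$ be a real Lévy process of type $I$ with Lévy–Khinchine triplet $(A,\gamma,\nu)$, so that $A=0$ and $\int_{-\infty}^{\infty}\nu(dx)<\infty$, and suppose that $\gamma-\int_{|y|<1}y\,\nu(dy)=0$. Then the infinitesimal generator $L$ of $X_t$ has the form $$Lf(x)=-\Omega f(x)+\int_{-\infty}^{\infty}f(y)\,d_y\nu(y-x),\qquad \Omega=\int_{-\infty}^{\infty}d\nu(y),$$ for $f\in C_0^2$.
   Context: The triplet $(A,\gamma,\nu)$ of a Lévy process $X_t$ is defined by $E\{e^{izX_t}\}=e^{-t\lambda(z)}$, $\lambda(z)=\frac12Az^2-i\gamma z-\int_{-\infty}^{\infty}(e^{ixz}-1-ixz1_{|x|<1})\nu(dx)$, with $A\ge 0$, $\gamma\in\mathbb R$ and $\int\frac{x^2}{1+x^2}\nu(dx)<\infty$. $C_0$ is the Banach space (sup norm) of continuous functions on $\mathbb R$ tending to $0$ at $\pm\infty$, and $C_0^2$ is the set of $f\in C_0$ with $f',f''\in C_0$. $L$ is the infinitesimal generator of the strongly continuous semigroup $P_tf(x)=E f(x+X_t)$ on $C_0$; on $C_0^2$ it is given by $Lf=\frac12Af''+\gamma f'+\int_{-\infty}^{\infty}(f(x+y)-f(x)-yf'(x)1_{|y|<1})\nu(dy)$. The notation $d\nu(x)=\nu(dx)$ is used, and $\int g(y)\,d_y\nu(y-x)$ means integration against the translate of $\nu$ by $x$, i.e. $\int g(x+u)\,\nu(du)$. *)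

(* Defs.v *)
From HB Require Import structures.
From mathcomp Require Export all_boot all_order all_algebra.
From mathcomp Require Export all_classical all_reals all_analysis.
From mathcomp Require Export complex.

Set Implicit Arguments.
Unset Strict Implicit.
Unset Printing Implicit Defensive.
Export Order.TTheory GRing.Theory Num.Theory.
Export numFieldNormedType.Exports.

Local Open Scope classical_set_scope.
Local Open Scope ring_scope.

Definition cexp (R : realType) (z : R[i]) : R[i] :=
  Complex (expR (complex.Re z) * cos (complex.Im z))
          (expR (complex.Re z) * sin (complex.Im z)).

Definition Cintegral (R : realType) d (T : measurableType d)
    (mu : {measure set T -> \bar R}) (f : T -> R[i]) : R[i] :=
  Complex (\int[mu]_x complex.Re (f x)) (\int[mu]_x complex.Im (f x)).

(* Processes are indexed by all of R, but only times t >= 0 are constrained or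
   used. *)
Section Levy_process.
Context (R : realType) (d : measure_display) (T : measurableType d).
Variables (P : probability T R) (X : R -> {RV P >-> R}).

Definition increment (s t : R) : T -> R := fun w => X t w - X s w.

(* The factors B i may be the whole line, so the product rule for the full
   family contains the product rule for each of its subfamilies. *)
Definition independent_increments :=
  forall (n : nat) (t : nat -> R),
    0 <= t 0%N -> (forall i, t i < t i.+1) ->
  forall B : 'I_n -> set R, (forall i, measurable (B i)) ->
    P (\bigcap_(i in [set: 'I_n]) (increment (t i) (t i.+1) @^-1` B i)) =
    (\prod_(i < n) P (increment (t i) (t i.+1) @^-1` B i))%E.

Definition stationary_increments :=
  forall s t : R, 0 <= s -> s < t ->
  forall B : set R, measurable B ->
    P (increment s t @^-1` B) = P (X (t - s) @^-1` B).

Definition cadlag_paths :=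
  {ae P, forall w, forall t : R, 0 <= t ->
    X s w @[s --> t^'+] --> X t w /\
    (0 < t -> cvg (X s w @[s --> t^'-]))}.

Definition Levy_process :=
  [/\ {ae P, forall w, X 0 w = 0},
      independent_increments,
      stationary_increments &
      cadlag_paths].

Definition Levy_semigroup (t : R) (f : R -> R) : R -> R :=
  fun x => fine ('E_P[fun w => (f (x + X t w))%R]).

End Levy_process.

Section Levy_triplet.
Context (R : realType).
Implicit Types (A gamma z : R) (nu : {measure set R -> \bar R}).
Local Open Scope complex_scope.

Definition Levy_exponent A gamma nu z : R[i] :=
  (2^-1 * A * z ^+ 2)%:C - (gamma * z)*i
  - Cintegral nu (fun x : R =>
      cexp ((x * z)*i) - 1
      - (x * z * \1_[set u : R | `|u| < 1] x)*i).

Definition has_triplet d (T : measurableType d) (P : probability T R)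
    (X : R -> {RV P >-> R}) A gamma nu :=
  [/\ 0 <= A,
      (\int[nu]_x (x ^+ 2 / (1 + x ^+ 2))%:E < +oo)%E &
      forall t z : R, 0 <= t ->
        Cintegral P (fun w => cexp ((z * X t w)*i)) =
        cexp (- (t%:C * Levy_exponent A gamma nu z))].

Definition type_I A nu := A = 0 /\ (\int[nu]_x 1 < +oo)%E.

End Levy_triplet.

Section C0_generator.
Context (R : realType).
Implicit Types f g : R -> R.

Definition C0 f :=
  [/\ continuous f, f x @[x --> +oo] --> (0 : R) &
      f x @[x --> -oo] --> (0 : R)].

Definition C0_2 f :=
  [/\ C0 f, (forall x, derivable f x 1), C0 f^`()%classic,
      (forall x, derivable f^`()%classic x 1) & C0 f^`()^`()%classic].

Definition sup_norm f : \bar R := ereal_sup [set `|f x|%:E | x in [set: R]].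

(* [is_generator S f g]: f lies in the domain of the infinitesimal generator L
   of the semigroup S on C_0, and L f = g. *)
Definition is_generator (S : R -> (R -> R) -> R -> R) f g :=
  [/\ C0 f, C0 g &
      sup_norm (fun x => (S t f x - f x) / t - g x) @[t --> 0^'+]
        --> (0 : \bar R)%E].

End C0_generator.

(* Main.v *)
Require Import Defs.
From mathcomp Require Import ring lra measurable_realfun.

(** With zero drift and finite [nu], the Levy-Khinchine exponent collapses to
    E exp(i z X_t) = exp(t psi(z)), psi(z) = int (exp(i z u) - 1) nu(du).  Let
    P_t be the semigroup and let L g(x) = int (g(x + u) - g(x)) nu(du), a
    bounded operator of norm at most 2 Omega for the supremum norm.

    On a trigonometric sum g both operators act diagonally, with eigenvalues
    exp(t psi(z)) and psi(z).  Hence t |-> P_t g(x) is smooth with derivative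
    P_t (L g)(x), and, since P_t is a contraction, its second derivative is at
    most (2 Omega)^2 sup |g|.  Two applications of the mean value theorem give
      |P_t g(x) - g(x) - t L g(x)| <= (2 Omega)^2 sup |g| t^2
    ([trig_sum_expansion]).  The bound depends on g only through its supremum,
    so it passes to every bounded pointwise limit of trigonometric sums by
    dominated convergence ([Levy_semigroup_expansion]).

    Every bounded continuous f is such a limit, with the same bound
    ([trig_approx_bound], [trig_approx_cvg]).  The approximants are
    Bernstein-like: average f over the endpoint of a random walk with k^3 steps
    of length k^-2 and bias sin(x / k).  This endpoint has mean k sin(x / k),
    which tends to x, and variance at most 1 / k; and a finite average whose
    weights are polynomials in sin(x / k) is a trigonometric sum in x
    ([trigonometric_walk]).

    Dividing the estimate for f by t gives the uniform convergence of the
    difference quotients; that L f is again in C_0 is dominated convergence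
    along sequences ([C0_convolution]). *)

Local Open Scope classical_set_scope.
Local Open Scope ring_scope.

Set Implicit Arguments.
Unset Strict Implicit.
Unset Printing Implicit Defensive.

(** * Elementary estimates *)

Section sine_bounds.
Context {R : realType}.
Implicit Types (f df : R -> R) (t y : R).

Lemma MVT_ge0 f df t : (forall x : R, is_derive x 1 f (df x)) -> 0 <= t ->
  exists2 c, 0 <= c <= t & f t - f 0 = df c * t.
Proof.
move=> fdf t0.
have [|c /[!in_itv]/= ct ->] := @MVT_segment R f df 0 t t0 (fun x _ => fdf x).
  by apply: derivable_within_continuous => x _; have [] := fdf x.
by exists c => //; rewrite subr0.
Qed.

Lemma cosB1_bound y : 0 <= y -> `|cos y - 1| <= y.
Proof.
move=> y0.
have [c _] := MVT_ge0 (@is_derive_cos R) y0.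
rewrite cos0 => ->; rewrite normrM normrN (ger0_norm y0).
by rewrite ler_piMl// ler_norml sin_geN1 sin_le1.
Qed.

Lemma sin_sub_id_bound y : `|sin y - y| <= y ^+ 2.
Proof.
wlog y0 : y / 0 <= y => [H|].
  have [/H//|/ltW y0] := leP 0 y.
  by have := H (- y); rewrite oppr_ge0 sinN sqrrN -opprD normrN => ->.
have [c /andP[c0 cy]] := MVT_ge0 (@is_derive_sin R) y0.
rewrite sin0 subr0 => ->.
rewrite -{2}[y]mul1r -mulrBl normrM (ger0_norm y0) expr2 ler_wpM2r//.
exact: le_trans (cosB1_bound c0) cy.
Qed.

End sine_bounds.

(** * Approximation by biased random walks *)

Section biased_walk.
Context {R : realType}.
Implicit Types (F : R -> R) (b h s c l e C : R).

(** The expectation of [F] at the endpoint of an [n]-step walk from [s] whose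
    steps are [h] or [- h] with probabilities [(1 + b) / 2] and [(1 - b) / 2]. *)
Fixpoint walk F b h (n : nat) s : R :=
  if n is m.+1 then
    (1 + b) / 2 * walk F b h m (s + h) + (1 - b) / 2 * walk F b h m (s - h)
  else F s.

(** Chebyshev's argument: the factor of [C] is the mean square distance from
    [c] to the endpoint, which has mean [s + n h b] and variance
    [n h^2 (1 - b^2)]. *)
Lemma walk_dist F b h l e C c : `|b| <= 1 ->
  (forall u, `|F u - l| <= e + C * (u - c) ^+ 2) ->
  forall n s, `|walk F b h n s - l| <=
    e + C * ((s + h *+ n * b - c) ^+ 2 + h ^+ 2 *+ n * (1 - b ^+ 2)).
Proof.
rewrite ler_norml => /andP[b1 b2] FC; elim=> [|n IH] s /=.
  by rewrite !mulr0n !mul0r !addr0; exact: FC.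
have p0 : 0 <= (1 + b) / 2 by lra.
have q0 : 0 <= (1 - b) / 2 by lra.
set v := walk _ _ _ _ _; set w := walk _ _ _ _ _.
have -> : (1 + b) / 2 * v + (1 - b) / 2 * w - l =
  (1 + b) / 2 * (v - l) + (1 - b) / 2 * (w - l) by field.
apply: (le_trans (ler_normD _ _)).
rewrite (normrM _ (v - l)) (normrM _ (w - l)) (ger0_norm p0) (ger0_norm q0).
apply: (le_trans (lerD (ler_wpM2l p0 (IH _)) (ler_wpM2l q0 (IH _)))).
rewrite le_eqVlt; apply/orP; left; apply/eqP.
by field.
Qed.

(** The endpoint has mean [K sin (x / K)] and variance at most [1 / K], where
    [K = k + 1]. *)
Definition trig_approx F k x : R :=
  walk F (sin (k.+1%:R^-1 * x)) (k.+1%:R ^- 2) (k.+1 ^ 3) 0.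

Lemma trig_approx_bound F B k x : (forall u, `|F u| <= B) ->
  `|trig_approx F k x| <= B.
Proof.
move=> FB.
have FB0 u : `|F u - 0| <= B + 0 * (u - 0) ^+ 2 by rewrite mul0r addr0 subr0.
rewrite -(subr0 (trig_approx _ _ _)).
apply: le_trans (walk_dist _ _ FB0 _ _) _; last by rewrite mul0r addr0.
by rewrite ler_norml sin_geN1 sin_le1.
Qed.

Lemma trig_approx_cvg F B x : (forall u, `|F u| <= B) ->
  {for x, continuous F} -> trig_approx F k x @[k --> \oo] --> F x.
Proof.
move=> FB /cvgrPdist_le Fx; apply/cvgrPdist_le => e e0.
have e2 : 0 < e / 2 by rewrite divr_gt0.
have /nbhs_ballP[r /= r0 rF] := Fx _ e2.
have B0 : 0 <= B := le_trans (normr_ge0 _) (FB 0).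
(* Beyond distance r of x the oscillation 2 B is dominated by the quadratic
   term. *)
pose C := B * 2 / r ^+ 2.
have C0 : 0 <= C by rewrite divr_ge0 ?exprn_ge0 ?(ltW r0)// mulr_ge0.
have FC u : `|F u - F x| <= e / 2 + C * (u - x) ^+ 2.
  have [ur|ur] := ltP `|x - u| r.
    by rewrite distrC ler_wpDr ?(mulr_ge0 C0 (sqr_ge0 _))//; exact: rF.
  rewrite ler_wpDl ?(ltW e2)//.
  apply: (@le_trans _ _ (B * 2)).
    by rewrite (le_trans (ler_normB _ _))// mulr2n mulrDr mulr1 lerD.
  rewrite /C -mulrA ler_peMr ?(mulr_ge0 B0)// mulrC ler_pdivlMr ?exprn_gt0//.
  rewrite mul1r -(real_normK (num_real (u - x))) distrC.
  by apply: lerXn2r; rewrite // nnegrE ltW.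
pose D := C * (x ^+ 4 + 1).
near=> k.
have k0 : 0 < (k.+1%:R : R) by rewrite ltr0n.
have k1 : 1 <= (k.+1%:R : R) by rewrite ler1n.
rewrite distrC; apply: le_trans (walk_dist _ _ FC _ _) _.
  by rewrite ler_norml sin_geN1 sin_le1.
rewrite add0r.
set K : R := k.+1%:R in k0 k1 *; set b := sin _.
have -> : K ^- 2 *+ k.+1 ^ 3 = K.
  by rewrite -mulr_natr natrX -/K; field; rewrite gt_eqF.
have -> : (K ^- 2) ^+ 2 *+ k.+1 ^ 3 = K^-1.
  by rewrite -mulr_natr natrX -/K; field; rewrite gt_eqF.
have drift : (K * b - x) ^+ 2 <= x ^+ 4 / K.
  have -> : K * b - x = K * (b - K^-1 * x) by field; rewrite gt_eqF.
  rewrite exprMn -(real_normK (num_real (b - _))).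
  have := sin_sub_id_bound (K^-1 * x); rewrite -/b => bx.
  apply: (@le_trans _ _ (K ^+ 2 * ((K^-1 * x) ^+ 2) ^+ 2)).
    by rewrite ler_wpM2l ?sqr_ge0// lerXn2r// nnegrE ?sqr_ge0.
  have -> : K ^+ 2 * ((K^-1 * x) ^+ 2) ^+ 2 = x ^+ 4 / K / K.
    by field; rewrite gt_eqF.
  rewrite ler_pdivrMr// ler_peMr// divr_ge0 ?(ltW k0)//.
  by rewrite -[4%N]/(2 * 2)%N exprM sqr_ge0.
have spread : K^-1 * (1 - b ^+ 2) <= K^-1.
  by rewrite ler_piMr ?invr_ge0 ?(ltW k0)// gerBl sqr_ge0.
rewrite [leRHS](splitr e) lerD2l; apply: (@le_trans _ _ (D / K)).
  by rewrite /D -mulrA ler_wpM2l// mulrDl mul1r; exact: lerD.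
rewrite ler_pdivrMr// -ler_pdivrMl//.
apply: (@le_trans _ _ k%:R); last by rewrite ler_nat.
by near: k; exact: nbhs_infty_ger.
Unshelve. all: by end_near. Qed.

End biased_walk.

(** * Trigonometric sums *)

Section trigonometric_sums.
Context {R : realType}.
Implicit Types (s : seq (R * R * R)) (g : R -> R) (x : R).

(** A term [(c, z, a)] stands for [c cos (z x + a)]; with phases allowed, real
    sums of cosines suffice where exponentials would be complex. *)
Definition trig_sum s x : R := \sum_(k <- s) k.1.1 * cos (k.1.2 * x + k.2).

Lemma trig_sum_cons k s x :
  trig_sum (k :: s) x = k.1.1 * cos (k.1.2 * x + k.2) + trig_sum s x.
Proof. by rewrite /trig_sum big_cons. Qed.

Lemma trig_sum_cat s1 s2 x :
  trig_sum (s1 ++ s2) x = trig_sum s1 x + trig_sum s2 x.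
Proof. by rewrite /trig_sum big_cat. Qed.

Lemma continuous_trig_sum s : continuous (trig_sum s).
Proof.
elim: s => [|k s IH] x.
  rewrite (_ : trig_sum [::] = cst 0); first exact: cvg_cst.
  by apply/funext => y; rewrite /trig_sum big_nil.
rewrite (_ : trig_sum (k :: s) =
  fun y => k.1.1 * cos (k.1.2 * y + k.2) + trig_sum s y); last first.
  by apply/funext => y; rewrite trig_sum_cons.
apply: cvgD; last exact: IH.
apply: cvgMr; apply: (@continuous_comp _ _ _ (fun y => k.1.2 * y + k.2) cos).
  by apply: cvgD; [apply: cvgMr; exact: cvg_id|exact: cvg_cst].
exact: continuous_cos.
Qed.

Lemma measurable_trig_sum s : measurable_fun setT (trig_sum s).
Proof. by apply: continuous_measurable_fun; exact: continuous_trig_sum. Qed.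

Definition trigonometric g := exists s, g = trig_sum s.

Lemma trigonometric_cst (a : R) : trigonometric (cst a).
Proof.
exists [:: (a, 0, 0)]; apply/funext => x.
by rewrite trig_sum_cons /trig_sum big_nil mul0r !addr0 cos0 mulr1.
Qed.

Lemma trigonometricD g1 g2 :
  trigonometric g1 -> trigonometric g2 -> trigonometric (g1 \+ g2).
Proof.
move=> [s1 ->] [s2 ->]; exists (s1 ++ s2).
by apply/funext => x; rewrite trig_sum_cat.
Qed.

Lemma trigonometricZ (a : R) g :
  trigonometric g -> trigonometric (fun x => a * g x).
Proof.
move=> [s ->]; exists [seq (a * k.1.1, k.1.2, k.2) | k <- s].
apply/funext => x; rewrite /trig_sum big_map mulr_sumr.
by apply: eq_bigr => k _; rewrite mulrA.
Qed.

(** Product-to-sum formula; the phase shift by [pi / 2] turns the resulting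
    sines into cosines. *)
Lemma trigonometric_mulsin (w : R) g :
  trigonometric g -> trigonometric (fun x => sin (w * x) * g x).
Proof.
move=> [s ->].
exists ([seq (k.1.1 / 2, k.1.2 + w, k.2 - pi / 2) | k <- s] ++
        [seq (- (k.1.1 / 2), k.1.2 - w, k.2 - pi / 2) | k <- s]).
apply/funext => x; rewrite trig_sum_cat /trig_sum !big_map mulr_sumr -big_split.
apply: eq_bigr => k _ /=.
set t := k.1.2 * x + k.2.
have -> : (k.1.2 + w) * x + (k.2 - pi / 2) = (t + w * x) - pi / 2.
  by rewrite /t; ring.
have -> : (k.1.2 - w) * x + (k.2 - pi / 2) = (t - w * x) - pi / 2.
  by rewrite /t; ring.
by rewrite !cosBpihalf sinD sinB; field.
Qed.

Lemma trigonometric_walk F (w h : R) n c :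
  trigonometric (fun x => walk F (sin (w * x)) h n c).
Proof.
elim: n c => [|n IH] c; first exact: trigonometric_cst.
set g1 := fun x => walk F (sin (w * x)) h n (c + h).
set g2 := fun x => walk F (sin (w * x)) h n (c - h).
have -> : (fun x => walk F (sin (w * x)) h n.+1 c) =
  ((fun x => 2^-1 * g1 x) \+ (fun x => 2^-1 * (sin (w * x) * g1 x))) \+
  ((fun x => 2^-1 * g2 x) \+ (fun x => - 2^-1 * (sin (w * x) * g2 x))).
  by apply/funext => x /=; rewrite -/(g1 x) -/(g2 x); field.
by do ![apply: trigonometricD | apply: trigonometricZ
  | apply: trigonometric_mulsin | exact: IH].
Qed.

End trigonometric_sums.

(** * Fourier multipliers on trigonometric sums *)

Section evolution.
Context {R : realType} (p q : R -> R).
Implicit Types (s : seq (R * R * R)) (t x : R).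

(** The multiplier [exp (t psi)] for the complex symbol [psi = p + i q], in
    real form. *)
Definition evolve s t x : R := \sum_(k <- s)
  k.1.1 * (expR (t * p k.1.2) * cos (k.1.2 * x + k.2 + t * q k.1.2)).

(** The multiplier [psi] itself. *)
Definition symbol_mul s : seq (R * R * R) := flatten
  [seq [:: (k.1.1 * p k.1.2, k.1.2, k.2);
           (k.1.1 * q k.1.2, k.1.2, k.2 + pi / 2)] | k <- s].

Lemma evolve0 s x : evolve s 0 x = trig_sum s x.
Proof. by apply: eq_bigr => k _; rewrite !mul0r expR0 mul1r addr0. Qed.

Lemma is_derive_evolve s x t :
  is_derive t 1 (fun u => evolve s u x) (evolve (symbol_mul s) t x).
Proof.
elim: s => [|k s IH].
  rewrite (_ : (fun u => _) = cst 0).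
    by rewrite /evolve big_nil; exact: is_derive_cst.
  by apply/funext => u; rewrite /evolve big_nil.
rewrite (_ : (fun u => _) = (fun u => k.1.1 *
    (expR (u * p k.1.2) * cos (k.1.2 * x + k.2 + u * q k.1.2))) +
  (fun u => evolve s u x)); last first.
  by apply/funext => u; rewrite /evolve big_cons.
rewrite /evolve /symbol_mul /= !big_cons -/(symbol_mul s) addrA.
apply: is_deriveD.
set P := p k.1.2; set Q := q k.1.2; set w := _ + k.2.
have dP : is_derive t 1 (fun u => u * P) P.
  by apply: is_derive_eq; rewrite /GRing.scale/=; ring.
have dQ : is_derive t 1 (fun u => w + u * Q) Q.
  by apply: is_derive_eq; rewrite /GRing.scale/=; ring.
have := is_deriveZ k.1.1 (is_deriveM (is_derive1_comp (is_derive_expR _) dP)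
  (is_derive1_comp (is_derive_cos _) dQ)).
move=> /is_derive_eq; apply; rewrite /= -/P -/Q addrA.
by rewrite (addrAC _ (pi / 2)) cosDpihalf -/w /GRing.scale/=; ring.
Qed.

End evolution.

(** * Bounded integrands for a finite measure *)

Section finite_measure_integrals.
Context {R : realType} {d : measure_display} {T : measurableType d}.
Context (mu : {measure set T -> \bar R}) (mufin : (mu setT < +oo)%E).
Implicit Types (g : T -> R) (B x z : R).

Lemma bounded_integrable g B : measurable_fun setT g ->
  (forall w, `|g w| <= B) -> mu.-integrable setT (EFin \o g).
Proof.
move=> mg gB; apply: measurable_bounded_integrable => //.
exists B; split; first exact: num_real.
by move=> r Br w _; exact: le_trans (gB w) (ltW Br).
Qed.

Lemma Rintegral_bound g B : measurable_fun setT g ->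
  (forall w, `|g w| <= B) -> `|\int[mu]_w g w| <= B * fine (mu setT).
Proof.
move=> mg gB.
apply: le_trans (le_normr_Rintegral measurableT (bounded_integrable mg gB)) _.
rewrite -Rintegral_cst//; apply: le_Rintegral => //.
- apply: (@bounded_integrable _ B); first exact: measurableT_comp.
  by move=> w; rewrite normr_id.
- by apply: (@bounded_integrable _ `|B|) => //; exact: measurable_cst.
Qed.

Lemma Rintegral_bounded_cvg (g_ : nat -> T -> R) g B :
  (forall n, measurable_fun setT (g_ n)) ->
  (forall n w, `|g_ n w| <= B) ->
  (forall w, g_ n w @[n --> \oo] --> g w) ->
  \int[mu]_w g_ n w @[n --> \oo] --> \int[mu]_w g w.
Proof.
move=> mg gB gg.
have mlim : measurable_fun setT g.
  by apply: (measurable_fun_cvg mg) => w _; exact: gg.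
have [] := @dominated_convergence _ _ R mu setT measurableT
  (fun n w => (g_ n w)%:E) (EFin \o g) (cst B%:E).
- by move=> n; exact/measurable_EFinP.
- exact/measurable_EFinP.
- by apply/aeW => w _; apply: cvg_EFin; [exact: nearW|exact: gg].
- by apply: (@bounded_integrable (cst B) `|B|) => //; exact: measurable_cst.
- by apply/aeW => w n _ /=; rewrite lee_fin.
move=> ig _ cvgI; apply: fine_cvg; rewrite fineK//.
exact: integrable_fin_num.
Qed.

Context (Y : T -> R) (mY : measurable_fun setT Y).

Lemma measurable_fun_translate (g : R -> R) x : measurable_fun setT g ->
  measurable_fun setT (fun w => g (x + Y w)).
Proof. by move=> mg; apply: measurableT_comp => //; exact: measurable_funD. Qed.

Lemma integrable_cos z : mu.-integrable setT (EFin \o (fun w => cos (z * Y w))).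
Proof.
apply: (@bounded_integrable _ 1) => [|w].
  apply: (@measurableT_comp _ _ _ _ _ _ cos); last exact: measurable_funM.
  by apply: continuous_measurable_fun; exact: continuous_cos.
by rewrite ler_norml cos_geN1 cos_le1.
Qed.

Lemma integrable_sin z : mu.-integrable setT (EFin \o (fun w => sin (z * Y w))).
Proof.
apply: (@bounded_integrable _ 1) => [|w].
  apply: (@measurableT_comp _ _ _ _ _ _ sin); last exact: measurable_funM.
  by apply: continuous_measurable_fun; exact: continuous_sin.
by rewrite ler_norml sin_geN1 sin_le1.
Qed.

(** The right-hand side involves [mu] and [Y] only through the characteristic
    function of the image of [mu] by [Y]. *)
Lemma trig_sum_integral (s : seq (R * R * R)) x :
  \int[mu]_w trig_sum s (x + Y w) = \sum_(k <- s) k.1.1 *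
    ((\int[mu]_w cos (k.1.2 * Y w)) * cos (k.1.2 * x + k.2) -
     (\int[mu]_w sin (k.1.2 * Y w)) * sin (k.1.2 * x + k.2)).
Proof.
suff [] : mu.-integrable setT (EFin \o (fun w => trig_sum s (x + Y w))) /\
  \int[mu]_w trig_sum s (x + Y w) = \sum_(k <- s) k.1.1 *
    ((\int[mu]_w cos (k.1.2 * Y w)) * cos (k.1.2 * x + k.2) -
     (\int[mu]_w sin (k.1.2 * Y w)) * sin (k.1.2 * x + k.2)) by [].
elim: s => [|[[c z] a] s [ints IH]].
  have -> : (fun w => trig_sum [::] (x + Y w)) = cst 0.
    by apply/funext => w; rewrite /trig_sum big_nil.
  split; last by rewrite Rintegral_cst// mul0r big_nil.
  apply: (@bounded_integrable _ 0); first exact: measurable_cst.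
  by move=> w; rewrite normr0.
set b := z * x + a.
have icos : mu.-integrable setT (EFin \o (fun w => cos (z * Y w) * cos b)).
  exact: (integrableZr measurableT (cos b) (integrable_cos z)).
have isin : mu.-integrable setT (EFin \o (fun w => sin (z * Y w) * sin b)).
  exact: (integrableZr measurableT (sin b) (integrable_sin z)).
have idiff : mu.-integrable setT
    (EFin \o (fun w => cos (z * Y w) * cos b - sin (z * Y w) * sin b)).
  exact: (integrableB measurableT icos isin).
have iterm : mu.-integrable setT
    (EFin \o (fun w => c * (cos (z * Y w) * cos b - sin (z * Y w) * sin b))).
  exact: (integrableZl measurableT c idiff).
have -> : (fun w => trig_sum ((c, z, a) :: s) (x + Y w)) = (fun w =>
    c * (cos (z * Y w) * cos b - sin (z * Y w) * sin b) + trig_sum s (x + Y w)).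
  apply/funext => w; rewrite trig_sum_cons /=; congr (_ * _ + _).
  by rewrite -cosD /b; congr cos; ring.
split; first exact: (integrableD measurableT iterm ints).
rewrite big_cons RintegralD// IH RintegralZl// RintegralB// !RintegralZr//.
- exact: integrable_sin.
- exact: integrable_cos.
Qed.

End finite_measure_integrals.

(** * The space C_0 *)

Section C0_functions.
Context {R : realType}.
Implicit Types f : R -> R.

Lemma C0_bounded f : C0 f -> exists B : R, forall x, `|f x| <= B.
Proof.
move=> [fc fy fNy].
have /cvgrPdist_le/(_ _ ltr01)[M [_ My]] := fy.
have /cvgrPdist_le/(_ _ ltr01)[m [_ mNy]] := fNy.
have [||c _ fcmax] :=
  @EVT_max R (fun x => `|f x|) (Num.min m M) (Num.max m M).
- by rewrite ge_min le_max lexx.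
- apply: continuous_subspaceT => x; apply: continuous_comp; first exact: fc.
  exact: norm_continuous.
exists (Num.max 1 `|f c|) => x; rewrite le_max.
have [Mx|xM] := ltP M x.
  by have := My _ Mx; rewrite /= sub0r normrN => ->.
have [xm|mx] := ltP x m.
  by have := mNy _ xm; rewrite /= sub0r normrN => ->.
by rewrite fcmax ?orbT// in_itv/= ge_min mx /= le_max xM orbT.
Qed.

Lemma C0_lincomb (a b : R) f g :
  C0 f -> C0 g -> C0 (fun x => a * f x + b * g x).
Proof.
have lincvg (F : set_system R) (FF : Filter F) (l k : R) :
  f y @[y --> F] --> l -> g y @[y --> F] --> k ->
  (a * f y + b * g y) @[y --> F] --> a * l + b * k.
  by move=> fl gk; apply: cvgD; apply: cvgMr.
move=> [fc fy fNy] [gc gy gNy]; split.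
- by move=> x; apply: lincvg; [exact: fc|exact: gc].
- have := lincvg _ _ _ _ fy gy; rewrite !mulr0 addr0; exact.
- have := lincvg _ _ _ _ fNy gNy; rewrite !mulr0 addr0; exact.
Qed.

Lemma C0_convolution (nu : {measure set R -> \bar R}) f :
  (nu setT < +oo)%E -> C0 f -> C0 (fun x => \int[nu]_u f (x + u)).
Proof.
move=> nufin fC0; have [B fB] := C0_bounded fC0; case: fC0 => fc fy fNy.
have mf (x : R) : measurable_fun setT (fun u : R => f (x + u)).
  apply: measurable_fun_translate; first exact: measurable_id.
  exact: continuous_measurable_fun.
have intcvg (v : nat -> R) (g : R -> R) :
    (forall u, f (v n + u) @[n --> \oo] --> g u) ->
    \int[nu]_u f (v n + u) @[n --> \oo] --> \int[nu]_u g u.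
  by move=> vg; apply: (@Rintegral_bounded_cvg _ _ _ _ _ _ _ B).
have int0 : \int[nu]_u (cst 0 : R -> R) u = 0 by rewrite Rintegral_cst// mul0r.
have shift (v : nat -> R) (c : R) : v n @[n --> \oo] --> +oo ->
    (v n + c) @[n --> \oo] --> +oo.
  move=> /cvgryPge vy; apply/cvgryPge => A.
  by apply: filterS (vy (A - c)) => n; rewrite lerBlDr.
split.
- move=> x; apply/(@cvg_nbhsP R R^o) => v vx; apply: intcvg => u.
  apply: continuous_cvg; first exact: fc.
  by apply: cvgD => //; exact: cvg_cst.
- apply/cvg_pinftyP => v vy; rewrite -int0; apply: intcvg => u.
  by move/cvg_pinftyP: fy; apply; exact: shift.
- apply/cvgNy_compNP/cvg_pinftyP => v vy; rewrite -int0.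
  apply: (intcvg (fun n => - v n)) => u.
  move/cvgNy_compNP/cvg_pinftyP: fNy => /(_ _ (shift v (- u) vy)).
  by under eq_fun do rewrite /= opprD opprK.
Qed.

End C0_functions.

(** * The exponent and the jump operator of a finite Levy measure *)

Section finite_jump_measure.
Context {R : realType} (nu : {measure set R -> \bar R}).
Implicit Types (z t x B : R) (s : seq (R * R * R)) (f g : R -> R).

Definition jump_rate : R := \int[nu]_u (1 : R).

(** Real and imaginary part of [psi z], the integral of [exp (i z u) - 1]. *)
Definition cos_symbol z : R := \int[nu]_u cos (z * u) - jump_rate.
Definition sin_symbol z : R := \int[nu]_u sin (z * u).

Definition jump_operator f x : R := - jump_rate * f x + \int[nu]_u f (x + u).

Context (nufin : (nu setT < +oo)%E).

Lemma jump_rateE : jump_rate = fine (nu setT).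
Proof. by rewrite /jump_rate Rintegral_cst// mul1r. Qed.

Lemma jump_operator_trig_sum s :
  jump_operator (trig_sum s) = trig_sum (symbol_mul cos_symbol sin_symbol s).
Proof.
apply/funext => x; rewrite /jump_operator.
rewrite (trig_sum_integral nufin (@measurable_id _ _ setT)).
elim: s => [|k s IH].
  by rewrite /trig_sum !big_nil mulr0 addr0.
rewrite trig_sum_cons big_cons /symbol_mul /= !trig_sum_cons.
rewrite -/(symbol_mul _ _ s) -IH /= (addrA _ k.2) cosDpihalf.
by rewrite /cos_symbol /sin_symbol; ring.
Qed.

Lemma jump_operator_bound g B x : measurable_fun setT g ->
  (forall y, `|g y| <= B) -> `|jump_operator g x| <= 2 * jump_rate * B.
Proof.
move=> mg gB; rewrite (le_trans (ler_normD _ _))//.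
have r0 : 0 <= jump_rate by rewrite jump_rateE fine_ge0.
have -> : 2 * jump_rate * B = jump_rate * B + B * jump_rate by ring.
rewrite lerD//.
  by rewrite normrM normrN (ger0_norm r0) ler_wpM2l.
rewrite jump_rateE; apply: Rintegral_bound => //.
by apply: measurable_fun_translate => //; exact: measurable_id.
Qed.

(** The vanishing drift condition says exactly that [gamma] cancels the
    compensator of the small jumps. *)
Lemma Levy_exponent_finite_jumps gamma z :
  gamma - \int[nu]_(y in [set y : R | `|y| < 1]) y = 0 ->
  Levy_exponent 0 gamma nu z = Complex (- cos_symbol z) (- sin_symbol z).
Proof.
move=> /eqP; rewrite subr_eq0 => /eqP ->; set A := [set y : R | _].
have mA : measurable A.
  rewrite (_ : A = [set` `]-1, 1[%R]); first exact: measurable_itv.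
  by apply/seteqP; split => y; rewrite /A /= in_itv/= ltr_norml.
have icos : nu.-integrable setT (EFin \o (fun u => cos (z * u))).
  by apply: integrable_cos => //; exact: measurable_id.
have isin : nu.-integrable setT (EFin \o (fun u => sin (z * u))).
  by apply: integrable_sin => //; exact: measurable_id.
have ismall : nu.-integrable setT (EFin \o (fun u => u * \1_A u)).
  apply: (bounded_integrable nufin (B := 1)) => [|u].
    by apply: measurable_funM => //; exact: measurable_indic.
  rewrite indicE; case: (boolP (u \in A)) => [/[!inE] /ltW|_] /=.
    by rewrite mulr1.
  by rewrite mulr0 normr0.
have small : \int[nu]_(u in A) u = \int[nu]_u (u * \1_A u).
  rewrite Rintegral_mkcond; apply: eq_Rintegral => u _.
  by rewrite patchE indicE; case: ifP; rewrite (mulr1, mulr0).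
rewrite /Levy_exponent /Cintegral /cexp; apply/eqP; rewrite eq_complex /=.
rewrite expR0 small /cos_symbol /sin_symbol /jump_rate.
apply/andP; split; apply/eqP.
  transitivity (- \int[nu]_u (cos (z * u) - 1)).
    rewrite mulr0 mul0r !(subr0, add0r, oppr0); congr (- _).
    by apply: eq_Rintegral => u _; rewrite mul1r addr0 mulrC.
  rewrite RintegralB//; apply: (bounded_integrable nufin (B := 1)) => // u.
  by rewrite normr1.
transitivity (- (z * \int[nu]_u (u * \1_A u)) -
    \int[nu]_u (sin (z * u) - z * (u * \1_A u))).
  rewrite add0r (mulrC z); congr (- _ - _).
  by apply: eq_Rintegral => u _; rewrite mul1r subr0 (mulrC u z) mulrA.
rewrite RintegralB//; last exact: (integrableZl measurableT z ismall).
by rewrite RintegralZl//; ring.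
Qed.

Lemma char_fun_finite_jumps (d : measure_display) (T : measurableType d)
    (P : probability T R) (X : R -> {RV P >-> R}) (gamma : R) :
  has_triplet X 0 gamma nu ->
  gamma - \int[nu]_(y in [set y : R | `|y| < 1]) y = 0 ->
  forall t z, 0 <= t ->
  \int[P]_w cos (z * X t w) =
    expR (t * cos_symbol z) * cos (t * sin_symbol z) /\
  \int[P]_w sin (z * X t w) =
    expR (t * cos_symbol z) * sin (t * sin_symbol z).
Proof.
move=> [_ _ chf] nodrift t z t0.
have := chf t z t0; rewrite Levy_exponent_finite_jumps// /Cintegral /cexp.
move=> /eqP; rewrite eq_complex /= expR0 !mul0r !(subr0, addr0) !mulrN !opprK.
move=> /andP[/eqP re /eqP im]; split.
- by rewrite -re; apply: eq_Rintegral => w _; rewrite mul1r.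
- by rewrite -im; apply: eq_Rintegral => w _; rewrite mul1r.
Qed.

End finite_jump_measure.

(** * Second-order expansion of the semigroup *)

Section semigroup_expansion.
Context {R : realType} {d : measure_display} {T : measurableType d}.
Context (P : probability T R) (X : R -> {RV P >-> R}).
Context (nu : {measure set R -> \bar R}) (nufin : (nu setT < +oo)%E).
Implicit Types (z t x B : R) (s : seq (R * R * R)) (f g : R -> R).

Local Notation p := (cos_symbol nu).
Local Notation q := (sin_symbol nu).

Context (X_char : forall t z, 0 <= t ->
  \int[P]_w cos (z * X t w) = expR (t * p z) * cos (t * q z) /\
  \int[P]_w sin (z * X t w) = expR (t * p z) * sin (t * q z)).

Let Pfin : (P setT < +oo)%E.
Proof. by rewrite probability_setT ltry. Qed.

Lemma Levy_semigroupE t f x :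
  Levy_semigroup X t f x = \int[P]_w f (x + X t w).
Proof. by rewrite /Levy_semigroup unlock. Qed.

Lemma Levy_semigroup_trig_sum s t x : 0 <= t ->
  Levy_semigroup X t (trig_sum s) x = evolve p q s t x.
Proof.
move=> t0; rewrite Levy_semigroupE trig_sum_integral//.
apply: eq_bigr => k _; have [-> ->] := X_char k.1.2 t0.
by rewrite [in RHS]cosD; ring.
Qed.

Lemma Levy_semigroup_contraction g B t x : measurable_fun setT g ->
  (forall y, `|g y| <= B) -> `|Levy_semigroup X t g x| <= B.
Proof.
move=> mg gB; rewrite Levy_semigroupE.
rewrite -[leRHS]mulr1 (_ : 1 = fine (P setT)); last by rewrite probability_setT.
by apply: Rintegral_bound => //; exact: measurable_fun_translate.
Qed.

Lemma trig_sum_expansion s B t x : 0 <= t -> (forall y, `|trig_sum s y| <= B) ->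
  `|Levy_semigroup X t (trig_sum s) x - trig_sum s x -
    t * jump_operator nu (trig_sum s) x| <= (2 * jump_rate nu) ^+ 2 * B * t ^+ 2.
Proof.
move=> t0 sB; pose L := symbol_mul p q.
have LB y : `|trig_sum (L s) y| <= 2 * jump_rate nu * B.
  rewrite -jump_operator_trig_sum//; apply: jump_operator_bound => //.
  exact: measurable_trig_sum.
have LLB y : `|trig_sum (L (L s)) y| <= (2 * jump_rate nu) ^+ 2 * B.
  rewrite -jump_operator_trig_sum// expr2 -mulrA.
  by apply: jump_operator_bound => //; exact: measurable_trig_sum.
rewrite jump_operator_trig_sum// Levy_semigroup_trig_sum// -!(evolve0 p q).
have [c /andP[c0 ct] ->] := MVT_ge0 (fun u => is_derive_evolve p q s x u) t0.
rewrite (mulrC _ t) -mulrBr.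
have [b /andP[b0 bc] ->] := MVT_ge0 (fun u => is_derive_evolve p q (L s) x u) c0.
(* Reading the second derivative as the semigroup applied to a trigonometric
   sum bounds it by the contraction property. *)
rewrite -(Levy_semigroup_trig_sum _ _ b0) !normrM (ger0_norm t0) (ger0_norm c0).
rewrite mulrCA expr2 ler_pM ?mulr_ge0//.
  by apply: Levy_semigroup_contraction => //; exact: measurable_trig_sum.
by rewrite ler_wpM2l.
Qed.

Lemma Levy_semigroup_expansion f B t x : 0 <= t -> continuous f ->
  (forall y, `|f y| <= B) ->
  `|Levy_semigroup X t f x - f x - t * jump_operator nu f x| <=
  (2 * jump_rate nu) ^+ 2 * B * t ^+ 2.
Proof.
move=> t0 fc fB; pose h k := trig_approx f k.
have htrig k : trigonometric (h k) by exact: trigonometric_walk.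
have hB k y : `|h k y| <= B by exact: trig_approx_bound.
have hf y : h k y @[k --> \oo] --> f y by apply: trig_approx_cvg fB _; exact: fc.
have mh k : measurable_fun setT (h k).
  by have [s ->] := htrig k; exact: measurable_trig_sum.
have Pcvg : Levy_semigroup X t (h k) x @[k --> \oo] --> Levy_semigroup X t f x.
  rewrite Levy_semigroupE; under eq_fun do rewrite Levy_semigroupE.
  apply: (Rintegral_bounded_cvg Pfin (B := B)) => // k.
  exact: measurable_fun_translate.
have Lcvg : jump_operator nu (h k) x @[k --> \oo] --> jump_operator nu f x.
  apply: cvgD; first exact: cvgMr.
  apply: (Rintegral_bounded_cvg nufin (B := B)) => // k.
  by apply: measurable_fun_translate => //; exact: measurable_id.
have hcvg : (Levy_semigroup X t (h k) x - h k x - t * jump_operator nu (h k) x)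
    @[k --> \oo] --> Levy_semigroup X t f x - f x - t * jump_operator nu f x.
  by apply: cvgB; [exact: cvgB|exact: cvgMr].
rewrite -(cvg_lim (@Rhausdorff R) (cvg_norm hcvg)).
apply: limr_le; first exact: cvgP (cvg_norm hcvg).
apply: nearW => k; have [s hE] := htrig k; rewrite hE.
by apply: trig_sum_expansion => // y; rewrite -hE.
Qed.

End semigroup_expansion.

Unset Implicit Arguments.

Theorem proposition1p8 (R : realType) (d : measure_display)
    (T : measurableType d) (P : probability T R) (X : R -> {RV P >-> R})
    (A gamma : R) (nu : {measure set R -> \bar R}) :
  Levy_process X ->
  has_triplet X A gamma nu ->
  type_I A nu ->
  gamma - \int[nu]_(y in [set y : R | `|y| < 1]) y = 0 ->
  forall f : R -> R, C0_2 f ->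
    is_generator (Levy_semigroup X) f
      (fun x : R => - (\int[nu]_y (1 : R)) * f x + \int[nu]_u f (x + u)).
Proof.
move=> _ Xtriplet [A0 nufin] nodrift f [fC0 _ _ _ _].
rewrite integral_cst// mul1e in nufin; rewrite {}A0 in Xtriplet.
have X_char := char_fun_finite_jumps nufin Xtriplet nodrift.
split => //.
  have := C0_lincomb (- jump_rate nu) 1 fC0 (C0_convolution nufin fC0).
  by under eq_fun do rewrite mul1r.
have [B fB] := C0_bounded fC0; have [fc _ _] := fC0.
pose K := (2 * jump_rate nu) ^+ 2 * B.
apply: (@squeeze_cvge _ _ _ _ (cst 0%E) _ (fun t => (K * t)%:E)); last 2 first.
- exact: cvg_cst.
- apply: cvg_EFin; first exact: nearW.
  have /(@cvg_at_right_filter R R (fun t : R => K * t)) :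
      (K * t) @[t --> (0 : R)] --> K * 0.
    by apply: cvgMr; exact: cvg_id.
  by rewrite mulr0; apply.
near=> t; have t0 : 0 < t by [].
apply/andP; split.
  apply: le_ereal_sup_tmp; exists `|(Levy_semigroup X t f 0 - f 0) / t -
    jump_operator nu f 0|%:E; first by exists 0.
  by rewrite lee_fin.
apply: ge_ereal_sup => _ [x _ <-]; rewrite lee_fin -/(jump_operator nu f x).
rewrite -(ler_pM2r t0) -[X in _ * X <= _](gtr0_norm t0) -normrM mulrBl.
rewrite divfK ?gt_eqF// -mulrA -expr2 (mulrC _ t).
exact: (Levy_semigroup_expansion nufin X_char x (ltW t0) fc fB).
Unshelve. all: by end_near. Qed.
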